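(* Let $\mathbb{K}$ be a field, let $n \in \mathbb{N}$ and let $\lambda_1, \ldots, \lambda_n \in \mathbb{N}_0$. For each $i \in \{1,\ldots,n\}$ let $S_i$ be a finite $\lambda_i$-null subset of $\mathbb{K}$, and let $S := S_1 \times \cdots \times S_n$. Let $f \in \mathbb{K}[x_1,\ldots,x_n]$ and let $\alpha = (\alpha_1, \ldots, \alpha_n) \in \mathbb{N}_0^n$ with $\alpha_i < |S_i|$ for all $i$, such that $f$ contains the monomial $x_1^{\alpha_1} \cdots x_n^{\alpha_n}$ (with nonzero coefficient). Assume that for every monomial $x^{\gamma} = x_1^{\gamma_1}\cdots x_n^{\gamma_n}$ appearing in $f$ with $\gamma \neq \alpha$ there is $i \in \{1,\ldots,n\}$ such that \[ \gamma_i \in [0, \alpha_i - 1] \cup [\alpha_i + 1, |S_i| - 1] \cup [|S_i|, \alpha_i + \lambda_i]. \] Then there is $\mathbf{s} \in S$ such that $f(\mathbf{s}) \neq 0$.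
   Context: For $a, b$ integers, $[a,b] := \{x \in \mathbb{N}_0 \mid a \le x \le b\}$ (empty if $a > b$). For $\lambda \in \mathbb{N}_0$, a univariate polynomial $p \in \mathbb{K}[x]$ of degree $\nu \in \mathbb{N}_0$ is called $\lambda$-lacunary if all coefficients of $x^{k}$ with $\nu - \lambda \le k < \nu$ vanish. A finite set $A \subseteq \mathbb{K}$ is called $\lambda$-null if the polynomial $\prod_{a \in A}(x-a)$ is $\lambda$-lacunary. A polynomial ''contains'' a monomial if that monomial appears in it with nonzero coefficient. *)

(* Defs.v *)
From HB Require Import structures.
From mathcomp Require Import all_boot all_order all_algebra.
From mathcomp Require Import finmap mpoly.

Set Implicit Arguments.
Unset Strict Implicit.
Unset Printing Implicit Defensive.

Import Order.TTheory GRing.Theory Num.Theory.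
Local Open Scope ring_scope.

(* The bounds are integers, so that [0, a - 1] is empty when a = 0; with the
   truncated subtraction of nat it would be {0}. *)
Definition nat_itv (a b : int) : pred nat :=
  [pred x : nat | (a <= x%:Z) && (x%:Z <= b)].

(* The zero polynomial, which has no degree in N, is not lacunary. *)
Definition lacunary (K : fieldType) (lam : nat) (p : {poly K}) : Prop :=
  exists2 nu : nat, size p = nu.+1 &
    forall k : nat, (nu%:Z - lam%:Z <= k%:Z) && (k < nu)%N -> p`_k = 0.

Definition null_set (K : fieldType) (lam : nat) (A : {fset K}) : Prop :=
  lacunary lam (\prod_(a <- A) ('X - a%:P)).

(* Main.v *)
(* For each i there are weights w_i on S_i such that the functional
   p |-> sum_(a in S_i) w_i(a) p(a) takes the value 1 at x^(alpha_i) and 0 at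
   every other x^k with k < |S_i| or k <= alpha_i + lam_i: it extracts the
   coefficient of x^(alpha_i) in the remainder modulo prod_(a in S_i) (x - a),
   and the nullity of S_i makes the remainder of x^k of degree below alpha_i
   for |S_i| <= k <= alpha_i + lam_i. The tensor product of these functionals
   kills every monomial of f except x^alpha, so it maps f to the nonzero
   coefficient of x^alpha, whereas it only depends on the values of f on the
   grid. *)
Require Import Defs.
From HB Require Import structures.
From mathcomp Require Import all_boot all_order all_algebra.
From mathcomp Require Import finmap mpoly zify.

Set Implicit Arguments.
Unset Strict Implicit.
Unset Printing Implicit Defensive.

Import Order.TTheory GRing.Theory Num.Theory.
Local Open Scope ring_scope.

(** The Vandermonde matrix of the distinct nodes [rs] is invertible, and column [j] of its inverse
    provides the weights. *)
Lemma coef_functional (K : fieldType) (rs : seq K) (j : nat) :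
  uniq rs -> (j < size rs)%N ->
  exists w : K -> K, forall p : {poly K}, (size p <= size rs)%N ->
    \sum_(a <- rs) w a * p.[a] = p`_j.
Proof.
move=> rs_uniq j_lt; set N := size rs in j_lt *.
pose V : 'M[K]_N := Vandermonde N (\row_i rs`_i).
have V_unit : V \in unitmx.
  rewrite unitmxE det_Vandermonde unitfE.
  apply/prodf_neq0 => i _; apply/prodf_neq0 => i' lt_ii'.
  by rewrite !mxE subr_eq0 nth_uniq // neq_ltn lt_ii' orbT.
pose j' := Ordinal j_lt.
exists (fun a => if insub (index a rs) is Some i then invmx V i j' else 0).
move=> p p_le; rewrite (big_nth 0) big_mkord.
under eq_bigr => i _.
  rewrite index_uniq // valK (horner_coef_wide _ p_le) mulr_sumr.
  under eq_bigr => k _ do rewrite mulrCA.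
  over.
rewrite exchange_big (bigD1 j') //= [X in _ + X]big1 => [|k k_neq].
  rewrite addr0 -mulr_sumr -[RHS]mulr1; congr (_ * _).
  have /matrixP/(_ j' j') := mulmxV V_unit; rewrite !mxE eqxx mulr1n => <-.
  by apply: eq_bigr => i _; rewrite !mxE mulrC.
rewrite -mulr_sumr; have /matrixP/(_ k j') := mulmxV V_unit.
rewrite !mxE (negPf k_neq) => V0.
by rewrite (eq_bigr (fun i => V k i * invmx V i j')) ?V0 ?mulr0 // => i _;
   rewrite !mxE mulrC.
Qed.

Lemma null_set_functional (K : fieldType) (lam : nat) (A : {fset K}) (j : nat) :
  null_set lam A -> (j < #|` A|)%N ->
  exists w : K -> K,
    \sum_(a <- A) w a * a ^+ j = 1 /\
    forall k : nat, k != j -> (k < #|` A|)%N || (k <= j + lam)%N ->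
      \sum_(a <- A) w a * a ^+ k = 0.
Proof.
move=> [nu]; rewrite size_prod_XsubC => -[<-] lac j_lt.
have [w w_coef] := coef_functional (fset_uniq A) j_lt.
have powE k : (k < #|` A|)%N -> \sum_(a <- A) w a * a ^+ k = (j == k)%:R.
  move=> k_lt; rewrite -coefXn -w_coef ?size_polyXn //.
  by under [RHS]eq_bigr => a _ do rewrite hornerXn.
exists w; split=> [|k k_neq]; first by rewrite powE ?eqxx.
have [k_lt _ | k_ge /= k_le] := ltnP k #|` A|.
  by rewrite powE // eq_sym (negPf k_neq).
set g := \prod_(a <- A) ('X - a%:P) in lac.
have g_coef : g`_#|` A| = 1.
  have /monicP : g \is monic by apply: monic_prod_XsubC.
  by rewrite lead_coefE size_prod_XsubC.
(* As x^k = x^t x^|A|, the polynomial p is congruent to x^k modulo g. *)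
pose t := (k - #|` A|)%N; pose p : {poly K} := 'X^t * ('X^#|` A| - g).
(* The leading terms of ['X^#|] A|[and]g[cancel. For]i >= j[, the bound]k <= j + lam[gives]i - t >=
   #|[A| - lam], which lies in the gap of [g]. *)
have p_size : (size p <= j)%N.
  apply/leq_sizeP => i i_ge; rewrite coefXnM; case: ltnP => // t_le.
  rewrite coefB coefXn; case: eqVneq => [-> | i_neq]; first by rewrite g_coef subrr.
  rewrite sub0r; have [i_lt | i_gt] := ltnP (i - t) #|` A|.
    rewrite lac ?oppr0 // i_lt andbT lerBlDr -PoszD lez_nat -(leq_add2l t).
    by rewrite subnK // addnA subnKC // (leq_trans k_le) // leq_add2r.
  by rewrite nth_default ?oppr0 // size_prod_XsubC ltn_neqAle eq_sym i_neq.
(* Since [g] vanishes on [A], [p] takes the values of [x^k] there, and its coefficient at [j] is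
   0. *)
transitivity (\sum_(a <- A) w a * p.[a]); last first.
  by rewrite w_coef ?nth_default // (leq_trans p_size) // ltnW.
apply: eq_big_seq => a a_A; congr (_ * _).
have /eqP g0 : root g a by rewrite root_prod_XsubC.
by rewrite !hornerE g0 subr0 -exprD subnK.
Qed.

(** Distributing a product over sums requires one finite index type for all factors, whereas the
    sets [S i] vary with [i]; this moves each sum to a common superset. *)
Lemma big_fset_subE (R : Type) (idx : R) (op : Monoid.com_law idx)
    (K : choiceType) (A U : {fset K}) (F : K -> R) :
  (A `<=` U)%fset ->
  \big[op/idx]_(a <- A) F a = \big[op/idx]_(u : U | val u \in A) F (val u).
Proof.
move=> /fsetIidPr A_U.
rewrite -(big_seq_fsetE _ _ (mem A)) [RHS]big_fset_condE -{1}A_U.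
by congr bigop; apply: congr1; apply/fsetP=> a; rewrite !inE.
Qed.

Theorem theorem2p1 (K : fieldType) (n : nat) (n_gt0 : (0 < n)%N)
    (lam : 'I_n -> nat) (S : 'I_n -> {fset K})
    (S_null : forall i : 'I_n, null_set (lam i) (S i))
    (f : {mpoly K[n]}) (alpha : 'X_{1..n})
    (alpha_lt : forall i : 'I_n, (alpha i < #|` S i|)%N)
    (alpha_supp : alpha \in msupp f)
    (f_supp : forall gamma : 'X_{1..n}, gamma \in msupp f -> gamma != alpha ->
       exists i : 'I_n,
         [\/ gamma i \in nat_itv 0 ((alpha i)%:Z - 1),
             gamma i \in nat_itv ((alpha i)%:Z + 1) (#|` S i|%:Z - 1)
           | gamma i \in nat_itv #|` S i|%:Z ((alpha i)%:Z + (lam i)%:Z)]) :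
  exists s : 'I_n -> K, (forall i : 'I_n, s i \in S i) /\ f.@[s] != 0.
Proof.
have /fin_all_exists[w w_spec] i := null_set_functional (S_null i) (alpha_lt i).
pose U : {fset K} := (\bigcup_(i <- enum 'I_n) S i)%fset.
have S_sub i : (S i `<=` U)%fset by rewrite bigfcup_sup ?mem_enum.
pose grid := family (fun i : 'I_n => [pred u : U | val u \in S i]).
have weighted_f (s : 'I_n -> K) : (\prod_i w i (s i)) * f.@[s] =
    \sum_(m <- msupp f) f@_m * \prod_i (w i (s i) * s i ^+ m i).
  rewrite mevalE mulr_sumr; apply: eq_bigr => m _.
  by rewrite mulrCA -big_split.
have sum_grid : \sum_(s in grid)
    (\prod_i w i (val (s i))) * f.@[fun i => val (s i)] = f@_alpha.
  under eq_bigr => s _ do rewrite weighted_f.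
  rewrite exchange_big /=.
  under eq_bigr => m _.
    rewrite -mulr_sumr.
    (* On a monomial, the grid sum factors into one-variable functionals. *)
    rewrite -(bigA_distr_big_dep _ (fun i u => w i (val u) * val u ^+ m i)).
    under eq_bigr => i _.
      rewrite -(big_fset_subE _ (fun a => w i a * a ^+ m i) (S_sub i)); over.
    over.
  rewrite (bigD1_seq alpha) //= ?msupp_uniq // [X in _ + X]big_seq_cond.
  rewrite [X in _ + X]big1 => [|m /andP[m_f m_neq]].
    by rewrite addr0 big1 ?mulr1 // => i _; case: (w_spec i).
  have [i m_i] := f_supp m m_f m_neq.
  suff w0 : \sum_(a <- S i) w i a * a ^+ m i = 0.
    by rewrite (bigD1 i) //= w0 mul0r mulr0.
  by case: (w_spec i) => _; apply; move: (alpha_lt i);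
    case: m_i; rewrite !inE; lia.
(* If [f] vanished on the whole grid, [sum_grid] would make the coefficient at [alpha] zero. *)
have [s /andP[s_grid f_s] | f0] :=
  pickP [pred s | (s \in grid) && (f.@[fun i => val (s i)] != 0)].
  by exists (fun i => val (s i)); split=> // i; move/familyP: s_grid; apply.
move: alpha_supp; rewrite mcoeff_msupp -sum_grid big1 ?eqxx // => s s_grid.
by move: (f0 s); rewrite /= s_grid /= => /negbFE/eqP ->; rewrite mulr0.
Qed.
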